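(* Let $\gamma:(a,b)\to (N^n,h)$ ($n\ge 2$) be a curve parametrized by arc length into a Riemannian manifold, with Frenet frame $\{F_1,\dots,F_n\}$ and curvatures $\kappa_1,\dots,\kappa_{n-1}$, and let $f:(a,b)\to(0,+\infty)$ be a function. Then $\gamma$ is $f$-biharmonic if and only if $$\begin{cases} -3\kappa_1\kappa_1'-2\kappa_1^2 f'/f=0,\\ \kappa_1''-\kappa_1\kappa_2^2-\kappa_1^3+\kappa_1R^N(F_1,F_2,F_1,F_2)+\kappa_1 f''/f+2\kappa_1'f'/f=0,\\ 2\kappa_1'\kappa_2+\kappa_1\kappa_2'+\kappa_1R^N(F_1,F_2,F_1,F_3)+2\kappa_1\kappa_2f'/f=0,\\ \kappa_1\kappa_2\kappa_3+\kappa_1R^N(F_1,F_2,F_1,F_4)=0,\\ \kappa_1R^N(F_1,F_2,F_1,F_j)=0,\quad j=5,\dots,n. \end{cases}$$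
   Context: Everything is smooth. For a map $\varphi:(M,g)\to(N,h)$, the tension field is $\tau(\varphi)=\mathrm{Trace}_g\nabla d\varphi$ and the bitension field is $\tau_2(\varphi)=\mathrm{Trace}_g(\nabla^\varphi\nabla^\varphi-\nabla^\varphi_{\nabla^M})\tau(\varphi)-\mathrm{Trace}_gR^N(d\varphi,\tau(\varphi))d\varphi$, with $R^N(X,Y)Z=[\nabla^N_X,\nabla^N_Y]Z-\nabla^N_{[X,Y]}Z$. For $f:M\to(0,+\infty)$, $\varphi$ is $f$-biharmonic if $f\tau_2(\varphi)+(\Delta f)\tau(\varphi)+2\nabla^\varphi_{\mathrm{grad} f}\tau(\varphi)=0$. For an arclength parametrized curve $\gamma$ this is $$f\big(\nabla^N_{\gamma'}\nabla^N_{\gamma'}\nabla^N_{\gamma'}\gamma'-R^N(\gamma',\nabla^N_{\gamma'}\gamma')\gamma'\big)+2f'\nabla^N_{\gamma'}\nabla^N_{\gamma'}\gamma'+f''\nabla^N_{\gamma'}\gamma'=0.$$ A Frenet frame along $\gamma$ is an orthonormal frame $\{F_i\}$ along $\gamma$ with $F_1=\gamma'$, $\nabla_{F_1}F_1=\kappa_1F_2$, $\nabla_{F_1}F_i=-\kappa_{i-1}F_{i-1}+\kappa_iF_{i+1}$ for $2\le i\le n-1$, and $\nabla_{F_1}F_n=-\kappa_{n-1}F_{n-1}$. The functions $\kappa_i$ are the curvatures of $\gamma$. The convention for the $(0,4)$ tensor is $R^N(X,Y,Z,W)=-\langle R^N(X,Y)Z,W\rangle$, so that $R^N(F_1,F_2,F_1,F_2)$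 is the sectional curvature of the plane spanned by $F_1,F_2$. Curvatures $\kappa_i$ with $i\ge n$ are read as $0$, and equations or terms involving $F_j$ with $j>n$ are absent. *)

(* Defs.v *)
From mathcomp Require Export all_boot all_order all_algebra.
From mathcomp Require Export all_classical all_reals all_analysis.

Set Implicit Arguments.
Unset Strict Implicit.
Unset Printing Implicit Defensive.

Export Order.TTheory GRing.Theory Num.Theory.
Export numFieldNormedType.Exports.

#[global] Open Scope classical_set_scope.
#[global] Open Scope ring_scope.

(** Smooth maps, manifolds, Riemannian metrics *)

(* All iterated directional derivatives of [h] exist and are (Frechet)
   differentiable on [U]; meant for [U] open in a finite-dimensional space, where
   it says that [h] is C^oo on [U]. *)
Definition smooth_on (R : realType) (V W : normedModType R) (U : set V)
    (h : V -> W) : Prop :=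
  forall (s : seq V) (x : V), U x ->
    differentiable (foldr (fun v k => fun y => 'D_v k y) h s) x.

(* [cinv] is total; it is meaningful only on [cmap @` cdom]. *)
Record chart (R : realType) (n : nat) (N : topologicalType) := Chart {
  cdom : set N;
  cmap : N -> 'rV[R]_n;
  cinv : 'rV[R]_n -> N;
  cdom_open : open cdom;
  cimg_open : open (cmap @` cdom);
  cmapK : forall p, cdom p -> cinv (cmap p) = p;
  cmap_continuous : forall p, cdom p -> {for p, continuous cmap};
  cinv_continuous : forall x, (cmap @` cdom) x -> {for x, continuous cinv} }.

Definition cimg (R : realType) (n : nat) (N : topologicalType)
  (c : chart R n N) : set 'rV[R]_n := cmap c @` cdom c.

Definition transition (R : realType) (n : nat) (N : topologicalType)
  (c d : chart R n N) : 'rV[R]_n -> 'rV[R]_n := cmap d \o cinv c.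

Record manifold (R : realType) (n : nat) := Manifold {
  carrier :> topologicalType;
  carrier_hausdorff : hausdorff_space carrier;
  carrier_second_countable : @second_countable carrier;
  atlas : set (chart R n carrier);
  atlas_cover : forall p : carrier, exists2 c, atlas c & cdom c p;
  atlas_compatible : forall c d, atlas c -> atlas d ->
    smooth_on (cmap c @` (cdom c `&` cdom d)) (transition c d) }.

Definition gram_form (R : realType) (n : nat) (A : 'M[R]_n)
  (u v : 'rV[R]_n) : R := (u *m A *m v^T) 0 0.

(* [gmx c x] is the matrix g_ij of the metric in the chart [c] at the point of
   coordinates [x]; [gmx_transition] says that these matrices are the
   expressions of a single tensor. *)
Record riemannian_manifold (R : realType) (n : nat) := RiemannianManifold {
  base :> manifold R n;
  gmx : chart R n base -> 'rV[R]_n -> 'M[R]_n;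
  gmx_smooth : forall c, atlas c -> smooth_on (cimg c) (gmx c);
  gmx_sym : forall c x, atlas c -> cimg c x -> (gmx c x)^T = gmx c x;
  gmx_pos : forall c x (u : 'rV[R]_n), atlas c -> cimg c x -> u != 0 ->
    0 < gram_form (gmx c x) u u;
  gmx_transition : forall c d x (u v : 'rV[R]_n), atlas c -> atlas d ->
    (cmap c @` (cdom c `&` cdom d)) x ->
    gram_form (gmx c x) u v =
    gram_form (gmx d (transition c d x))
      ('d (transition c d) x u) ('d (transition c d) x v) }.

(** Levi-Civita connection and curvature in a chart *)

Section Chart.
Variables (R : realType) (n : nat) (N : riemannian_manifold R n).
Variable c : chart R n N.
Implicit Types (x u v w z : 'rV[R]_n) (X Y Z : 'rV[R]_n -> 'rV[R]_n).

Definition metric x u v : R := gram_form (gmx c x) u v.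

(* d_i g_jl *)
Definition dgmx x (i j l : 'I_n) : R :=
  'D_('e_i) (fun y => gmx c y j l) x.

(* Gamma^k_ij *)
Definition christoffel x (k i j : 'I_n) : R :=
  2^-1 * \sum_(l < n) invmx (gmx c x) k l *
         (dgmx x i j l + dgmx x j i l - dgmx x l i j).

Definition christoffel_form x u v : 'rV[R]_n :=
  \row_(k < n) \sum_(i < n) \sum_(j < n) christoffel x k i j * u 0 i * v 0 j.

(* Vector fields on the domain of [c] are written in coordinates. *)
Definition nabla X Y : 'rV[R]_n -> 'rV[R]_n :=
  fun x => 'D_(X x) Y x + christoffel_form x (X x) (Y x).

Definition lie_bracket X Y : 'rV[R]_n -> 'rV[R]_n :=
  fun x => 'D_(X x) Y x - 'D_(Y x) X x.

Definition curvature_op X Y Z : 'rV[R]_n -> 'rV[R]_n :=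
  fun x => nabla X (nabla Y Z) x - nabla Y (nabla X Z) x
           - nabla (lie_bracket X Y) Z x.

(* R^N(u,v)w at x : by tensoriality the vectors may be extended arbitrarily,
   here by the fields with constant components. *)
Definition curvature x u v w : 'rV[R]_n :=
  curvature_op (cst u) (cst v) (cst w) x.

(* The sign makes [curvature4 x u v u v] the sectional curvature of an
   orthonormal pair [u], [v]. *)
Definition curvature4 x u v w z : R := - metric x (curvature x u v w) z.

End Chart.

(** Curves and vector fields along them *)

Section Curve.
Variables (R : realType) (n : nat) (N : riemannian_manifold R n).
Variables (I : set R) (gamma : R -> N).

(* A vector field along [gamma] is given by its components in every chart:
   [V c t] are the components in [c] of its value at time [t], meaningful when
   [gamma t] belongs to the domain of [c]. *)
Definition field : Type := chart R n N -> R -> 'rV[R]_n.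
Implicit Types V W : field.

(* A statement about tensors along [gamma] holds when it does in the components
   of every chart of the atlas around every point of the curve. *)
Definition along (P : chart R n N -> R -> Prop) : Prop :=
  forall c t, atlas c -> I t -> cdom c (gamma t) -> P c t.

Definition coord (c : chart R n N) (t : R) : 'rV[R]_n := cmap c (gamma t).

Definition smooth_curve : Prop :=
  (forall t, I t -> {for t, continuous gamma}) /\
  forall c, atlas c ->
    smooth_on (W := 'rV[R]_n) (I `&` gamma @^-1` cdom c : set R^o) (coord c).

Definition smooth_field V : Prop :=
  (forall c, atlas c ->
    smooth_on (W := 'rV[R]_n) (I `&` gamma @^-1` cdom c : set R^o) (V c)) /\
  along (fun c t => forall d, atlas d -> cdom d (gamma t) ->
    V d t = 'd (transition c d) (coord c t) (V c t)).

Definition velocity : field := fun c t => derive1 (coord c) t.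

(* covariant derivative along [gamma] with respect to gamma' *)
Definition cov V : field := fun c t =>
  derive1 (V c) t + christoffel_form c (coord c t) (velocity c t) (V c t).

Definition inner V W (c : chart R n N) (t : R) : R :=
  metric c (coord c t) (V c t) (W c t).

Definition curv (V1 V2 V3 : field) : field := fun c t =>
  curvature c (coord c t) (V1 c t) (V2 c t) (V3 c t).

Definition curv4 (V1 V2 V3 V4 : field) (c : chart R n N) (t : R) : R :=
  curvature4 c (coord c t) (V1 c t) (V2 c t) (V3 c t) (V4 c t).

Definition arclength : Prop := along (fun c t => inner velocity velocity c t = 1).

(* The domain is an interval with its standard flat metric, so that the trace
   has the single term d/dt, and [Delta f = f''], [grad f = f' d/dt]. *)
Definition tension : field := cov velocity.

Definition bitension : field := fun c t =>
  cov (cov tension) c t - curv velocity tension velocity c t.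

Definition f_biharmonic (f : R -> R) : Prop :=
  along (fun c t =>
    f t *: bitension c t + derive1n 2 f t *: tension c t
      + (2 * derive1 f t) *: cov tension c t = 0).

(* Indices start at 1; [F i] is used for 1 <= i <= n only, and the curvatures
   kappa_i with i >= n are set to 0. *)
Record frenet_frame (F : nat -> field) (kappa : nat -> R -> R) : Prop := {
  frenet_smooth : forall i, (1 <= i <= n)%N -> smooth_field (F i);
  frenet_curvature_smooth : forall i, (1 <= i < n)%N ->
    smooth_on (V := R^o) (W := R^o) I (kappa i);
  frenet_curvature0 : forall i t, (n <= i)%N -> kappa i t = 0;
  frenet_orthonormal : forall i j, (1 <= i <= n)%N -> (1 <= j <= n)%N ->
    along (fun c t => inner (F i) (F j) c t = (i == j)%:R);
  frenet_velocity : along (fun c t => F 1%N c t = velocity c t);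
  frenet_first : along (fun c t => cov (F 1%N) c t = kappa 1%N t *: F 2%N c t);
  frenet_mid : forall i, (2 <= i <= n.-1)%N ->
    along (fun c t => cov (F i) c t =
      - kappa i.-1 t *: F i.-1 c t + kappa i t *: F i.+1 c t);
  frenet_last :
    along (fun c t => cov (F n) c t = - kappa n.-1 t *: F n.-1 c t) }.

End Curve.

(* Main.v *)
Require Import Defs.
From mathcomp Require Import perm ring.

(** The Frenet equations express the first two covariant derivatives of
    [tension = kappa_1 F_2] in the frame, so the [f]-bitension field is a combination of
    [F_1, ..., F_4] minus [f kappa_1 R(F_1,F_2)F_1]. As the frame is orthonormal,
    the equation holds iff its inner products with all [F_j] vanish; these are
    [f] times the equations of the system, except that the one for [F_1] contains
    [R(F_1,F_2,F_1,F_1)]. This term is zero because [R(u,v)] is skew: the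
    antisymmetrized second derivative of [<w,w>], for [w] constant in a
    chart, is [2<R(u,v)w,w>] up to sign, and it vanishes since second derivatives commute. *)

Set Implicit Arguments.
Unset Strict Implicit.
Unset Printing Implicit Defensive.

(** * Directional derivatives and the symmetry of mixed ones *)

Section Calculus.
Context {R : realType} {V : normedModType R}.
Implicit Types (x u v : V) (h : V -> R).

(** The two difference quotients are the same function of the increment. This carries one-variable
    results, the mean value theorem and the chain rule, over to directional derivatives. *)
Lemma is_derive_lineP (h : V -> R) (dh : R) x v (r : R) :
  is_derive (x + r *: v) v h dh <-> is_derive r 1 (fun s : R => h (x + s *: v)) dh.
Proof.
have E : (fun k : R => k^-1 *: (h (x + (k *: (1 : R) + r) *: v) - h (x + r *: v)))
  = (fun k : R => k^-1 *: (h (k *: v + (x + r *: v)) - h (x + r *: v))).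
  apply/funext => k; congr (_ *: (h _ - _)).
  by rewrite scaler1 scalerDl addrCA.
by split=> -[d e]; split; move: d e; rewrite /derivable /derive E.
Qed.

Lemma mean_value_line h (dh : V -> R) x v (s : R) : 0 <= s ->
  (forall r : R, 0 <= r <= s -> is_derive (x + r *: v) v h (dh (x + r *: v))) ->
  exists2 r : R, 0 <= r <= s & h (x + s *: v) - h x = dh (x + r *: v) * s.
Proof.
move=> s0 hdh.
have der (r : R) : 0 <= r <= s ->
    is_derive r 1 (fun r : R => h (x + r *: v)) (dh (x + r *: v)).
  by move=> /hdh/is_derive_lineP.
have [r||r rs E] := @MVT_segment R (fun r => h (x + r *: v))
  (fun r => dh (x + r *: v)) 0 s s0.
- by rewrite in_itv/= => /andP[r0 rs]; apply: der; rewrite !ltW.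
- apply: derivable_within_continuous => r; rewrite in_itv/= => /der.
  by case.
- exists r; first by move: rs; rewrite in_itv.
  by move: E; rewrite scale0r addr0 subr0.
Qed.

Lemma is_derive_shiftv h (dh : R) x u w : is_derive (x + w) u h dh ->
  is_derive x u (fun y => h (y + w)) dh.
Proof.
have E : (fun k : R => k^-1 *: (h (k *: u + x + w) - h (x + w)))
  = (fun k : R => k^-1 *: (h (k *: u + (x + w)) - h (x + w))).
  by apply/funext => k; rewrite addrA.
by case=> d e; split; [rewrite /derivable E|rewrite /derive E].
Qed.

(** The second difference is an increment along [u] of [fun y => h (y + s *: v) - h y]. The mean
    value theorem along [u] turns it into an increment of [hu] along [v], to which the theorem
    applies again. *)
Lemma mean_value_square h (hu huv : V -> R) x u v (s : R) : 0 <= s ->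
  (forall r t : R, 0 <= r <= s -> 0 <= t <= s ->
    let y := x + r *: u + t *: v in
    is_derive y u h (hu y) /\ is_derive y v hu (huv y)) ->
  exists r t : R, [/\ 0 <= r <= s, 0 <= t <= s &
    h (x + s *: u + s *: v) - h (x + s *: u) - (h (x + s *: v) - h x) =
    huv (x + r *: u + t *: v) * s * s].
Proof.
move=> s0 dh.
have ss : 0 <= s <= s by rewrite s0 lexx.
have zs : 0 <= (0 : R) <= s by rewrite s0 lexx.
have key (r : R) : 0 <= r <= s ->
    is_derive (x + r *: u) u (fun y => h (y + s *: v) - h y)
     (hu (x + r *: u + s *: v) - hu (x + r *: u)).
  move=> rs; apply: is_deriveB.
    by apply: is_derive_shiftv; have [] := dh _ _ rs ss.
  by have [] := dh _ _ rs zs; rewrite scale0r addr0.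
have [r rs E1] := @mean_value_line (fun y => h (y + s *: v) - h y)
  (fun y => hu (y + s *: v) - hu y) x u s s0 key.
have [t ts E2] := mean_value_line s0 (fun t ts => (dh r t rs ts).2).
by exists r, t; split => //; rewrite E1 E2.
Qed.

(* Both mixed derivatives are, by the mean value theorem, limits of the same
   second-order difference quotient over small squares based at [x]. *)
Lemma mixed_derivativesC h (hu hv huv hvu : V -> R) x u v :
  (\forall y \near x, [/\ is_derive y u h (hu y), is_derive y v h (hv y),
     is_derive y v hu (huv y) & is_derive y u hv (hvu y)]) ->
  {for x, continuous huv} -> {for x, continuous hvu} -> huv x = hvu x.
Proof.
move=> nh cuv cvu; apply/eqP; rewrite -subr_eq0 -normr_le0.
apply/ler_addgt0Pl => e e0; rewrite addr0.
have e2 : 0 < e / 2 by rewrite divr_gt0.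
have /cvgrPdist_lt/(_ _ e2) n1 := cuv.
have /cvgrPdist_lt/(_ _ e2) n2 := cvu.
have [d /= d0 sub] := (nbhs_ballP _ _).1 (filterI nh (filterI n1 n2)).
(* This side length keeps the square spanned by [s *: u] and [s *: v] inside the ball of radius [d];
   the added 1 covers the case where [u] and [v] are both zero. *)
pose s := d / (`|u| + `|v| + 1).
have D0 : 0 < `|u| + `|v| + 1 by rewrite ltr_wpDl// addr_ge0.
have s0 : 0 < s by rewrite divr_gt0.
have near_sq (r t : R) : 0 <= r <= s -> 0 <= t <= s -> ball x d (x + r *: u + t *: v).
  move=> /andP[r0 rs] /andP[t0 ts]; rewrite -ball_normE /ball_/=.
  rewrite -addrA opprD addNKr normrN (le_lt_trans (ler_normD _ _))//.
  rewrite !normrZ (ger0_norm r0) (ger0_norm t0).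
  rewrite (@le_lt_trans _ _ (s * (`|u| + `|v|)))//.
    by rewrite mulrDr lerD// ler_wpM2r.
  by rewrite /s mulrAC ltr_pdivrMr// ltr_pM2l// ltrDl.
have near_sq' (r t : R) : 0 <= r <= s -> 0 <= t <= s -> ball x d (x + r *: v + t *: u).
  by move=> rs ts; rewrite addrAC; exact: near_sq.
have [|r [t [rs ts E1]]] := @mean_value_square h hu huv x u v s (ltW s0).
  by move=> r t rs ts; have [[]] := sub _ (near_sq _ _ rs ts).
have [|r' [t' [rs' ts' E2]]] := @mean_value_square h hv hvu x v u s (ltW s0).
  by move=> r' t' rs' ts'; have [[]] := sub _ (near_sq' _ _ rs' ts').
have [_ [A _]] := sub _ (near_sq _ _ rs ts).
have [_ [_ B]] := sub _ (near_sq' _ _ rs' ts').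
have E0 : x + s *: v + s *: u = x + s *: u + s *: v by rewrite addrAC.
rewrite {}E0 in E2.
(* The second difference is symmetric in [u] and [v], so the two intermediate values agree after
   division by [s] twice. This common value is within [e / 2] of both [huv x] and [hvu x]. *)
have E : hvu (x + r' *: v + t' *: u) = huv (x + r *: u + t *: v).
  apply: (mulIf (lt0r_neq0 s0)); apply: (mulIf (lt0r_neq0 s0)).
  by rewrite -E1 -E2; move: (h _) (h _) (h _) (h x) => *; ring.
rewrite E distrC in B.
rewrite [e]splitr (le_trans (ler_distD (huv (x + r *: u + t *: v)) _ _))//.
by rewrite lerD// ltW.
Qed.

Lemma is_derive_mxP m n (M : V -> 'M[R]_(m, n)) (dM : 'M[R]_(m, n)) x v :
  is_derive x v M dM <-> forall i j, is_derive x v (fun y => M y i j) (dM i j).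
Proof.
split=> [[dMx <-] i j|H].
  split; first by move/derivable_mxP : dMx.
  by rewrite derive_mx// mxE.
have dMx : derivable M x v by apply/derivable_mxP => i j; case: (H i j).
apply: DeriveDef => //.
by rewrite derive_mx//; apply/matrixP => i j; rewrite mxE; case: (H i j).
Qed.

Lemma is_derive_bigsum (T : Type) (r : seq T) (f : T -> V -> R) (df : T -> R) x v :
  (forall i, is_derive x v (f i) (df i)) ->
  is_derive x v (fun y => \sum_(i <- r) f i y) (\sum_(i <- r) df i).
Proof.
move=> H; elim: r => [|a r IH].
  by rewrite big_nil (_ : (fun _ => _) = cst 0); [exact: is_derive_cst|
    apply/funext => y; rewrite big_nil].
rewrite big_cons (_ : (fun _ => _) = f a + (fun y => \sum_(i <- r) f i y)).
  exact: is_deriveD.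
by apply/funext => y; rewrite big_cons.
Qed.

Lemma derivable_bigsum (T : Type) (r : seq T) (f : T -> V -> R) x v :
  (forall i, derivable (f i) x v) ->
  derivable (fun y => \sum_(i <- r) f i y) x v.
Proof.
by move=> H; have [] := is_derive_bigsum r (fun i => derivableP (H i)).
Qed.

Lemma derivable_bigprod (T : Type) (r : seq T) (f : T -> V -> R) x v :
  (forall i, derivable (f i) x v) ->
  derivable (fun y => \prod_(i <- r) f i y) x v.
Proof.
move=> H; elim: r => [|a r IH].
  by rewrite (_ : (fun _ => _) = cst 1); [exact: derivable_cst|
    apply/funext => y; rewrite big_nil].
rewrite (_ : (fun _ => _) = f a * (fun y => \prod_(i <- r) f i y)).
  exact: (derivableM (H a) IH).
by apply/funext => y; rewrite big_cons.
Qed.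

Lemma is_derive_mulmx m n p (M : V -> 'M[R]_(m, n)) (P : V -> 'M[R]_(n, p))
    (dM : 'M[R]_(m, n)) (dP : 'M[R]_(n, p)) x v :
  is_derive x v M dM -> is_derive x v P dP ->
  is_derive x v (fun y => M y *m P y) (dM *m P x + M x *m dP).
Proof.
move=> /is_derive_mxP HM /is_derive_mxP HP; apply/is_derive_mxP => i k.
rewrite (_ : (fun _ => _) = (fun y => \sum_j M y i j * P y j k)); last first.
  by apply/funext => y; rewrite mxE.
rewrite !mxE -big_split/=; apply: is_derive_bigsum => j.
have HMij := HM i j; have HPjk := HP j k.
apply: (is_derive_eq (is_deriveM HMij HPjk)).
by rewrite /GRing.scale/=; ring.
Qed.

Lemma is_derive_scalemx m n (k : V -> R) (M : V -> 'M[R]_(m, n))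
    (dk : R) (dM : 'M[R]_(m, n)) x v :
  is_derive x v k dk -> is_derive x v M dM ->
  is_derive x v (fun y => k y *: M y) (dk *: M x + k x *: dM).
Proof.
move=> Hk /is_derive_mxP HM; apply/is_derive_mxP => i j.
rewrite (_ : (fun _ => _) = k * (fun y => M y i j)); last first.
  by apply/funext => y; rewrite mxE.
have HMij := HM i j.
apply: (is_derive_eq (is_deriveM Hk HMij)).
by rewrite !mxE /GRing.scale/=; ring.
Qed.

Lemma derivable_det n (A : V -> 'M[R]_n) x v :
  derivable A x v -> derivable (fun y => \det (A y)) x v.
Proof.
move=> /derivable_mxP dA.
have H (s : 'S_n) : derivable (fun y => (-1) ^+ s * \prod_i A y i (s i)) x v.
  apply: (@derivableM _ _ (cst ((-1) ^+ s))); first exact: derivable_cst.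
  exact: derivable_bigprod.
exact: derivable_bigsum.
Qed.

(** By Cramer's formula the inverse is the adjugate over the determinant, both polynomial in the
    entries. *)
Lemma derivable_invmx n (A : V -> 'M[R]_n) x v :
  (\forall y \near x, A y \in unitmx) -> derivable A x v ->
  derivable (fun y => invmx (A y)) x v.
Proof.
move=> uA dA.
have dadj : derivable (fun y => \adj (A y)) x v.
  apply/derivable_mxP => i j.
  rewrite (_ : (fun _ => _) = (fun y => cofactor (A y) j i)); last first.
    by apply/funext => y; rewrite mxE.
  apply: (@derivableM _ _ (cst _)); first exact: derivable_cst.
  apply: derivable_det; apply/derivable_mxP => k l.
  rewrite (_ : (fun _ => _) = (fun y => A y (lift j k) (lift i l))).
    by move/derivable_mxP : dA.
  by apply/funext => y; rewrite !mxE.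
have ddet := derivable_det dA.
have det0 : \det (A x) != 0.
  by have := nbhs_singleton uA; rewrite unitmxE unitfE.
have dinv : derivable (fun y => (\det (A y))^-1) x v.
  exact: (@derivableV _ _ (fun y => \det (A y)) x v det0 ddet).
have [D _] := is_derive_scalemx (derivableP dinv) (derivableP dadj).
(* [invmx] returns its argument on singular matrices, so the formula is used only near [x], where
   [A] is invertible. *)
apply: near_eq_derivable D.
by near=> y; rewrite /invmx; have -> : A y \in unitmx by near: y.
Unshelve. all: by end_near. Qed.

(** Only a derivative along [v] is given, so homogeneity in the direction comes from the chain rule
    for [s |-> k * s] on the line through [x]. *)
Lemma is_derive_scaledir m n (M : V -> 'M[R]_(m, n)) (dM : 'M[R]_(m, n)) x v (k : R) :
  is_derive x v M dM -> is_derive x (k *: v) M (k *: dM).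
Proof.
move=> /is_derive_mxP H; apply/is_derive_mxP => i j.
rewrite -{1}[x]addr0 -(scale0r (k *: v)); apply/is_derive_lineP.
rewrite (_ : (fun _ => _) =
    (fun s : R => M (x + s *: v) i j) \o (fun s : R => k * s)); last first.
  by apply/funext => s /=; rewrite scalerA mulrC.
rewrite mxE mulrC; apply: is_derive1_comp.
  rewrite mulr0; apply/(is_derive_lineP (fun y => M y i j)).
  by rewrite scale0r addr0.
have := @is_deriveZ _ _ _ (@id R) k 0 1 1 (is_derive_id _ _).
by rewrite /GRing.scale/= mulr1.
Qed.

(** Extracts iterated derivatives from [smooth_on]. The head of the list is the direction
    differentiated last: [[:: v; u]] stands for ['D_v ('D_u G)]. *)
Lemma smooth_on_derivable (W : normedModType R) (U : set V) (G : V -> W) (s : seq V) x v :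
  smooth_on U G -> U x ->
  is_derive x v (foldr (fun v k => fun y => 'D_v k y) G s)
    (foldr (fun v k => fun y => 'D_v k y) G (v :: s) x).
Proof. by move=> sG Ux; apply: DeriveDef => //; exact: diff_derivable (sG s x Ux). Qed.

Lemma smooth_on_deriveC m n (U : set V) (G : V -> 'M[R]_(m, n)) x u v :
  open U -> smooth_on U G -> U x -> 'D_v ('D_u G) x = 'D_u ('D_v G) x.
Proof.
move=> oU sG Ux; apply/matrixP => i j.
have cont s : {for x, continuous
    (fun y => (foldr (fun v k => fun y => 'D_v k y) G s y) i j)}.
  have cM := differentiable_continuous (sG s x Ux).
  exact: (continuous_comp cM (@coord_continuous _ _ _ i j _)).
apply: (@mixed_derivativesC (fun y => G y i j) (fun y => ('D_u G y) i j)
  (fun y => ('D_v G y) i j) (fun y => ('D_v ('D_u G) y) i j)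
  (fun y => ('D_u ('D_v G) y) i j) x u v).
- have nU : \forall y \near x, U y by apply: open_nbhs_nbhs.
  near=> y.
  have Uy : U y by near: y.
  split.
  + by move/is_derive_mxP: (smooth_on_derivable [::] u sG Uy); apply.
  + by move/is_derive_mxP: (smooth_on_derivable [::] v sG Uy); apply.
  + by move/is_derive_mxP: (smooth_on_derivable [:: u] v sG Uy); apply.
  + by move/is_derive_mxP: (smooth_on_derivable [:: v] u sG Uy); apply.
- exact: (cont [:: v; u]).
- exact: (cont [:: u; v]).
Unshelve. all: by end_near. Qed.

End Calculus.

(** * Bilinear forms given by a matrix *)

Section GramForm.
Context {R : realType} {n : nat}.
Implicit Types (A : 'M[R]_n) (u v w : 'rV[R]_n).

Lemma gram_formDl A u v w : gram_form A (u + v) w = gram_form A u w + gram_form A v w.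
Proof. by rewrite /gram_form !mulmxDl mxE. Qed.

Lemma gram_formZl A k u w : gram_form A (k *: u) w = k * gram_form A u w.
Proof. by rewrite /gram_form -!scalemxAl mxE. Qed.

Lemma gram_formBl A u v w : gram_form A (u - v) w = gram_form A u w - gram_form A v w.
Proof. by rewrite gram_formDl -scaleN1r gram_formZl mulN1r. Qed.

Lemma gram_formC A u v : A^T = A -> gram_form A u v = gram_form A v u.
Proof.
move=> AT; have E : v *m A *m u^T = (u *m A *m v^T)^T.
  by rewrite !trmx_mul trmxK AT mulmxA.
by rewrite /gram_form E [RHS]mxE.
Qed.

Lemma gram_formE A u v : gram_form A u v = \sum_i \sum_j A i j * u 0 i * v 0 j.
Proof.
rewrite /gram_form mxE exchange_big; apply: eq_bigr => j _.
rewrite !mxE mulr_suml; apply: eq_bigr => i _.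
by rewrite [A i j * _]mulrC.
Qed.

Lemma is_derive_gram_form (V : normedModType R) (A : V -> 'M[R]_n)
    (a : V -> 'rV[R]_n) (dA : 'M[R]_n) (da : 'rV[R]_n) (x v : V) w :
  is_derive x v A dA -> is_derive x v a da ->
  is_derive x v (fun y => gram_form (A y) (a y) w)
    (gram_form dA (a x) w + gram_form (A x) da w).
Proof.
move=> HA Ha.
have /is_derive_mxP/(_ 0 0) :=
  is_derive_mulmx (is_derive_mulmx Ha HA) (is_derive_cst w^T x v).
by rewrite mulmx0 addr0 mulmxDl mxE addrC.
Qed.

End GramForm.

(** * The Levi-Civita connection and its curvature in a chart *)

Section Chart.
Context {R : realType} {n : nat} (N : riemannian_manifold R n) (c : chart R n N).
Hypothesis hc : atlas c.
Implicit Types (x u v w : 'rV[R]_n).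

Local Notation G := (gmx c).
Local Notation Gam := (christoffel_form c).

Lemma near_cimg x : cimg c x -> \forall y \near x, cimg c y.
Proof. by move=> cx; apply: open_nbhs_nbhs; split => //; exact: cimg_open. Qed.

Lemma is_derive_gmx x v : cimg c x -> is_derive x v G ('D_v G x).
Proof. by move=> cx; exact: (smooth_on_derivable [::] v (gmx_smooth hc) cx). Qed.

Lemma is_derive_gmx2 x u v : cimg c x -> is_derive x v ('D_u G) ('D_v ('D_u G) x).
Proof. by move=> cx; exact: (smooth_on_derivable [:: u] v (gmx_smooth hc) cx). Qed.

Lemma gmx_unit x : cimg c x -> G x \in unitmx.
Proof.
move=> cx; rewrite -row_free_unit; apply: inj_row_free => u uG0.
apply/eqP/negP => /negP u0; have := gmx_pos hc cx u0.
by rewrite /gram_form uG0 mul0mx mxE ltxx.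
Qed.

Lemma deriv_gmxE x u i j : cimg c x -> 'D_u (fun y => G y i j) x = ('D_u G x) i j.
Proof.
by move=> cx; have /is_derive_mxP/(_ i j) [] := is_derive_gmx u cx.
Qed.

Lemma deriv_gmx_sym x u : cimg c x -> ('D_u G x)^T = 'D_u G x.
Proof.
move=> cx; apply/matrixP => i j; rewrite mxE -!deriv_gmxE//.
apply: near_eq_derive; have := near_cimg cx; apply: filterS => y cy.
by rewrite -[in RHS](gmx_sym hc cy) mxE.
Qed.

(** The differential of [G] is linear in the direction, which links the partial derivatives in the
    Christoffel symbols to derivatives along arbitrary vectors. *)
Lemma gram_deriv_gmx x u v w : cimg c x -> gram_form ('D_u G x) v w =
  \sum_i \sum_j \sum_l dgmx c x i j l * u 0 i * v 0 j * w 0 l.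
Proof.
move=> cx; rewrite gram_formE exchange_big/=.
under [RHS]eq_bigr do rewrite exchange_big/=.
rewrite [RHS]exchange_big/=; apply: eq_bigr => l _.
rewrite [RHS]exchange_big/=; apply: eq_bigr => j _.
have dG : differentiable G x := gmx_smooth hc [::] cx.
have -> : ('D_u G x) j l = \sum_i dgmx c x i j l * u 0 i.
  rewrite deriveE// {1}[u]row_sum_delta linear_sum summxE.
  apply: eq_bigr => i _; rewrite linearZ/= -deriveE// mxE mulrC.
  by rewrite /dgmx deriv_gmxE.
by rewrite !mulr_suml; apply: eq_bigr => i _.
Qed.

(** This is the Koszul formula for fields with constant components, whose brackets vanish. *)
Lemma metric_christoffel x u v w : cimg c x ->
  metric c x (Gam x u v) w = 2^-1 * (gram_form ('D_u G x) v w
    + gram_form ('D_v G x) u w - gram_form ('D_w G x) u v).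
Proof.
move=> cx; pose T i j l := dgmx c x i j l + dgmx c x j i l - dgmx c x l i j.
pose k := \row_l (\sum_i \sum_j 2^-1 * T i j l * u 0 i * v 0 j).
(* [k] is [Gam x u v] with its index lowered. [christoffel] contracts the second index of the
   inverse metric and the product with a row vector contracts the first; the symmetry of [G]
   reconciles them. *)
have -> : Gam x u v = k *m invmx (G x).
  rewrite -[in RHS](gmx_sym hc cx) -trmx_inv; apply/rowP => m; rewrite !mxE.
  under [RHS]eq_bigr do rewrite !mxE mulr_suml.
  rewrite [RHS]exchange_big/=; apply: eq_bigr => i _.
  under [RHS]eq_bigr do rewrite mulr_suml.
  rewrite [RHS]exchange_big/=; apply: eq_bigr => j _.
  rewrite /christoffel mulr_sumr !mulr_suml; apply: eq_bigr => l _.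
  by rewrite -/(T i j l); ring.
have -> : metric c x (k *m invmx (G x)) w = (k *m w^T) 0 0.
  by rewrite /metric /gram_form mulmxKV ?gmx_unit.
rewrite mxE.
(* Left visible, the directional derivatives make unification unfold their limits. *)
pose q a b d := gram_form ('D_a G x) b d.
have qE a b d : q a b d = _ := gram_deriv_gmx a b d cx.
change (\sum_l k 0 l * w^T l 0 = 2^-1 * (q u v w + q v u w - q w u v)).
move: q qE => q qE; rewrite !qE.
(* The sums for [q v u w] and [q w u v] are reindexed so that [i], [j], [l] always go with [u], [v],
   [w]. *)
rewrite [X in _ + X - _]exchange_big/=.
rewrite [X in _ - X](_ : _ = \sum_i \sum_j \sum_l
    dgmx c x l i j * u 0 i * v 0 j * w 0 l); last first.
  rewrite [LHS]exchange_big/=; apply: eq_bigr => i _.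
  rewrite [LHS]exchange_big/=; apply: eq_bigr => j _.
  by apply: eq_bigr => l _; ring.
rewrite -big_split -sumrB mulr_sumr/=.
under eq_bigr do rewrite !mxE mulr_suml.
rewrite [LHS]exchange_big/=; apply: eq_bigr => i _.
rewrite -big_split -sumrB mulr_sumr/=.
under eq_bigr do rewrite mulr_suml.
rewrite [LHS]exchange_big/=; apply: eq_bigr => j _.
rewrite -big_split -sumrB mulr_sumr/=; apply: eq_bigr => l _.
by rewrite /T; ring.
Qed.

Lemma metricC x v w : cimg c x -> metric c x v w = metric c x w v.
Proof. by move=> cx; exact/gram_formC/gmx_sym. Qed.

(** In the sum of the two Koszul formulas the derivatives along [v] and [w] cancel, and those along
    [u] are equal by symmetry. *)
Lemma metric_compatible x u v w : cimg c x ->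
  gram_form ('D_u G x) v w = metric c x (Gam x u v) w + metric c x v (Gam x u w).
Proof.
move=> cx; rewrite (metricC v)// !metric_christoffel//.
pose q a b d := gram_form ('D_a G x) b d.
have qC a b d : q a b d = q a d b by exact: gram_formC (deriv_gmx_sym a cx).
change (q u v w = 2^-1 * (q u v w + q v u w - q w u v)
  + 2^-1 * (q u w v + q w u v - q v u w)).
by move: q qC => q ->; field.
Qed.

Lemma derivable_christoffel_form x u v w : cimg c x ->
  derivable (fun y => Gam y v w) x u.
Proof.
move=> cx; apply/derivable_mxP => i k.
rewrite (_ : (fun _ => _) = (fun y => \sum_i \sum_j
    christoffel c y k i j * v 0 i * w 0 j)); last first.
  by apply/funext => y; rewrite mxE.
apply: derivable_bigsum => a; apply: derivable_bigsum => b.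
have mulc (h : 'rV[R]_n -> R) (r : R) : derivable h x u -> derivable (fun y => h y * r) x u.
  by move=> dh; exact: (derivableM dh (derivable_cst r x u)).
apply/mulc/mulc.
(* [dgmx] differentiates an entry of the metric, while smoothness concerns the whole matrix. The two
   agree on the image of the chart, hence near [x], which is what a further derivative requires. *)
have dg i' j' l' : derivable (fun y => dgmx c y i' j' l') x u.
  have [D _] := (is_derive_mxP _ _ _ _).1 (is_derive_gmx2 'e_i' u cx) j' l'.
  apply: near_eq_derivable D.
  by have := near_cimg cx; apply: filterS => y cy; rewrite /dgmx deriv_gmxE.
rewrite /christoffel; apply: (derivableM (derivable_cst _ x u)).
apply: derivable_bigsum => l; apply: derivableM.
  apply: (derivable_mxP _ _ _).1; apply: derivable_invmx.
    by have := near_cimg cx; apply: filterS => y; exact: gmx_unit.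
  by have [] := is_derive_gmx u cx.
exact: (derivableB (derivableD (dg _ _ _) (dg _ _ _)) (dg _ _ _)).
Qed.

Lemma christoffel_formZl x k v w : Gam x (k *: v) w = k *: Gam x v w.
Proof.
apply/rowP => m; rewrite !mxE mulr_sumr; apply: eq_bigr => i _.
by rewrite mulr_sumr; apply: eq_bigr => j _; rewrite !mxE; ring.
Qed.

Lemma christoffel_formZr x k v w : Gam x v (k *: w) = k *: Gam x v w.
Proof.
apply/rowP => m; rewrite !mxE mulr_sumr; apply: eq_bigr => i _.
by rewrite mulr_sumr; apply: eq_bigr => j _; rewrite !mxE; ring.
Qed.

Lemma christoffel_formDr x u v w : Gam x u (v + w) = Gam x u v + Gam x u w.
Proof.
apply/rowP => m; rewrite !mxE -big_split; apply: eq_bigr => i _.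
by rewrite -big_split; apply: eq_bigr => j _; rewrite !mxE/=; ring.
Qed.

(** Fields with constant components commute, and their covariant derivatives reduce to the
    Christoffel term. *)
Lemma curvatureE x u v w : curvature c x u v w =
  'D_u (fun y => Gam y v w) x + Gam x u (Gam x v w)
  - ('D_v (fun y => Gam y u w) x + Gam x v (Gam x u w)).
Proof.
have nablaE a : nabla c (cst a) (cst w) = (fun y => Gam y a w).
  by apply/funext => y; rewrite /nabla derive_cst add0r.
have bracket0 : lie_bracket (cst u) (cst v) x = 0.
  by rewrite /lie_bracket !derive_cst subr0.
have nabla0 : nabla c (lie_bracket (cst u) (cst v)) (cst w) x = 0.
  rewrite /nabla bracket0 derive0 add0r.
  by have := christoffel_formZl x 0 0 w; rewrite !scale0r.
by rewrite /curvature /curvature_op nabla0 subr0 !nablaE.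
Qed.

(** Serves to pull [kappa 1] out of the curvature term of the bitension field. *)
Lemma curvatureZ x k u v w : cimg c x ->
  curvature c x u (k *: v) w = k *: curvature c x u v w.
Proof.
move=> cx; rewrite !curvatureE.
have -> : 'D_u (fun y => Gam y (k *: v) w) x = k *: 'D_u (fun y => Gam y v w) x.
  rewrite -deriveZ; last exact: derivable_christoffel_form.
  by congr ('D_u _ x); apply/funext => y; rewrite christoffel_formZl.
have -> : 'D_(k *: v) (fun y => Gam y u w) x = k *: 'D_v (fun y => Gam y u w) x.
  have D := derivableP (@derivable_christoffel_form x v u w cx).
  by have [] := is_derive_scaledir k D.
by rewrite !christoffel_formZl christoffel_formZr scalerBr !scalerDr.
Qed.

(** For constant [w], compatibility gives the derivative of the squared norm of [w] along [u] as
    [2 * metric c x (Gam x u w) w]; differentiating along [v] and using compatibility again gives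
    the right-hand side. Its last summand is symmetric in [u] and [v]. *)
Lemma gram_deriv2_gmx x u v w : cimg c x ->
  gram_form ('D_v ('D_u G) x) w w =
  2 * (metric c x ('D_v (fun y => Gam y u w) x + Gam x v (Gam x u w)) w
       + metric c x (Gam x u w) (Gam x v w)).
Proof.
move=> cx.
have H1 : is_derive x v (fun y => gram_form ('D_u G y) w w)
    (gram_form ('D_v ('D_u G) x) w w).
  apply: is_derive_eq.
    exact: is_derive_gram_form (is_derive_gmx2 u v cx) (is_derive_cst w x v).
  by rewrite -(scale0r (0 : 'rV[R]_n)) gram_formZl mul0r addr0.
have H2 : is_derive x v (fun y => gram_form (G y) (Gam y u w) w)
    (gram_form ('D_v G x) (Gam x u w) w + metric c x ('D_v (fun y => Gam y u w) x) w).
  apply: is_derive_gram_form; first exact: is_derive_gmx.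
  exact/derivableP/derivable_christoffel_form.
have [_ <-] := H1.
have -> : 'D_v (fun y => gram_form ('D_u G y) w w) x =
    'D_v (fun y => 2 *: gram_form (G y) (Gam y u w) w) x.
  apply: near_eq_derive; have := near_cimg cx; apply: filterS => y cy.
  rewrite metric_compatible// (metricC w)// /metric.
  by rewrite [RHS]mulr_natl mulr2n.
have [D2 E2] := H2.
rewrite deriveZ// E2 metric_compatible// /metric gram_formDl /GRing.scale/=.
by ring.
Qed.

Lemma curvature_skew x u v w : cimg c x -> metric c x (curvature c x u v w) w = 0.
Proof.
move=> cx.
have S := smooth_on_deriveC u v (@cimg_open _ _ _ c) (gmx_smooth hc) cx.
have cancel (p q r s : R) : r = s -> 2 * (p + r) = 2 * (q + s) -> p = q.
  by move=> -> /mulfI; rewrite pnatr_eq0 => /(_ isT)/addIr.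
(* Exchanging [u] and [v] preserves the second derivative and the symmetric summand, so the
   remaining summands agree; their difference is the curvature term. *)
have E := cancel _ _ _ _ (metricC (Gam x u w) (Gam x v w) cx)
  (etrans (esym (gram_deriv2_gmx u v w cx))
  (etrans (congr1 (fun A => gram_form A w w) S) (gram_deriv2_gmx v u w cx))).
have sub0 (p q : 'rV[R]_n) : metric c x p w = metric c x q w -> metric c x (q - p) w = 0.
  by move=> pq; rewrite /metric gram_formBl; apply/eqP; rewrite subr_eq0; apply/eqP.
rewrite curvatureE; exact: (sub0 _ _ E).
Qed.

End Chart.

(** Orthonormality says that the square matrix [M] with rows [e i] has right inverse [A *m M^T].
    This is then also a left inverse, so [v] is recovered from its products with the [e j]. *)
Lemma gram_form_orthonormal_eq0 (R : realType) n (A : 'M[R]_n) (e : 'I_n -> 'rV[R]_n) v :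
  (forall i j, gram_form A (e i) (e j) = (i == j)%:R) ->
  (forall j, gram_form A v (e j) = 0) -> v = 0.
Proof.
move=> ortho v0; pose M := \matrix_(i, j) e i 0 j.
have M1 : M *m (A *m M^T) = 1%:M.
  apply/matrixP => i j; rewrite mulmxA [RHS]mxE -ortho /gram_form !mxE.
  apply: eq_bigr => k _; rewrite !mxE; congr (_ * _).
  by apply: eq_bigr => l _; rewrite !mxE.
have vM0 : v *m (A *m M^T) = 0.
  apply/rowP => j; rewrite mulmxA [RHS]mxE -(v0 j) /gram_form !mxE.
  by apply: eq_bigr => k _; rewrite !mxE.
by rewrite -[v]mulmx1 -(mulmx1C M1) mulmxA vM0 mul0mx.
Qed.

Lemma open_itv_ereal (R : realType) (a b : \bar R) : open [set t : R | (a < t%:E < b)%E].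
Proof.
rewrite (_ : [set t | _] = [set t : R | (a < t%:E)%E] `&` [set t : R | (t%:E < b)%E]).
  have open_mkset (P : R -> Prop) (A : set R) :
      open A -> (forall t, P t <-> A t) -> open [set t | P t].
    by move=> oA PA; rewrite (_ : mkset _ = A)//; apply/seteqP; split=> t /PA.
  apply: openI.
    case: a => [r||]; first exact: open_gt.
      by apply: (open_mkset _ _ open0) => t; split.
    by apply: (open_mkset _ _ openT) => t; split=> // _; exact: ltNyr.
  case: b => [r||]; first exact: open_lt.
    by apply: (open_mkset _ _ openT) => t; split=> // _; exact: ltry.
  by apply: (open_mkset _ _ open0) => t; split.
by apply/seteqP; split=> t /= => [/andP//|[-> ->]].
Qed.

(** * Rules for covariant derivatives along a curve *)

Section Covariant.
Context {R : realType} {n : nat} (N : riemannian_manifold R n).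
Variables (gamma : R -> N) (c : chart R n N).
Implicit Types (V W : field N) (t : R) (v w : 'rV[R]_n).

(** Derivability is recorded because [cov] is total: its value alone does not justify the sum and
    product rules. *)
Definition is_cov V t w := derivable (V c) t 1 /\ cov gamma V c t = w.

Lemma is_covD V W t v w : is_cov V t v -> is_cov W t w ->
  is_cov (fun c t => V c t + W c t) t (v + w).
Proof.
move=> [dV <-] [dW <-]; split; first exact: derivableD.
have E : 'D_1 (fun s => V c s + W c s) t = 'D_1 (V c) t + 'D_1 (W c) t.
  exact: deriveD.
rewrite /cov !derive1E E christoffel_formDr.
by rewrite !addrA; congr (_ + _); rewrite addrAC.
Qed.

Lemma is_covZ (k : R -> R) V t dk v : is_derive t 1 k dk -> is_cov V t v ->
  is_cov (fun c t => k t *: V c t) t (dk *: V c t + k t *: v).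
Proof.
move=> hk [/derivableP dV <-]; have [d e] := is_derive_scalemx hk dV.
split => //; rewrite /cov !derive1E e christoffel_formZr.
by rewrite -addrA -scalerDr.
Qed.

Lemma is_cov_near V W t v :
  (\forall s \near t, V c s = W c s) -> is_cov V t v -> is_cov W t v.
Proof.
move=> nVW [dV <-]; split; first exact: near_eq_derivable dV.
by rewrite /cov !derive1E (near_eq_derive _ nVW) (nbhs_singleton nVW).
Qed.

End Covariant.

Lemma derive1_cst0 (R : realType) : derive1 (cst 0 : R -> R) = cst 0.
Proof. by apply/funext => s; rewrite derive1E derive_cst. Qed.

(** * The tension and bitension fields in the Frenet frame *)

Section Frenet.
Context {R : realType} {n : nat} (N : riemannian_manifold R n).
Variables (I : set R) (gamma : R -> N) (F : nat -> field N) (kappa : nat -> R -> R).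
Hypotheses (hn : (2 <= n)%N) (oI : open I).
Hypotheses (hgamma : smooth_curve I gamma) (hF : frenet_frame I gamma F kappa).
Variable c : chart R n N.
Hypothesis hc : atlas c.

Local Notation U := [set t | I t /\ cdom c (gamma t)].

(** Identities between fields must hold on a neighbourhood of [t] before they can be differentiated
    covariantly at [t]. *)
Lemma near_curve_domain t : U t -> \forall s \near t, U s.
Proof.
move=> [It ct]; have nI : nbhs t I by apply: open_nbhs_nbhs.
have nc : nbhs t (gamma @^-1` cdom c).
  apply: (hgamma.1 t It); apply: open_nbhs_nbhs; split => //; exact: cdom_open.
by apply: filterI.
Qed.

Lemma is_derive_smooth_on (k : R -> R) t :
  smooth_on (V := R^o) (W := R^o) I k -> I t ->
  is_derive t 1 k (derive1 k t) /\ is_derive t 1 (derive1 k) (derive1n 2 k t).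
Proof.
move=> sk It; have k1 : derive1 k = 'D_1 k by apply/funext => s; rewrite derive1E.
split; first by rewrite k1; exact: (smooth_on_derivable [::] (1 : R^o) sk It).
have -> : derive1n 2 k = 'D_1 ('D_1 k).
  by apply/funext => s; rewrite derive1nS derive1n1 derive1E k1.
by rewrite k1; exact: (smooth_on_derivable [:: (1 : R^o)] (1 : R^o) sk It).
Qed.

Lemma kappa_junk i : (n <= i)%N -> kappa i = cst 0.
Proof. by move=> ni; apply/funext => t; exact: frenet_curvature0 hF _ t ni. Qed.

Lemma is_derive_kappa i t : (1 <= i)%N -> I t ->
  is_derive t 1 (kappa i) (derive1 (kappa i) t) /\
  is_derive t 1 (derive1 (kappa i)) (derive1n 2 (kappa i) t).
Proof.
move=> i1 It; have [ni|ni] := ltnP i n.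
  by apply: is_derive_smooth_on => //; apply: (frenet_curvature_smooth hF); rewrite i1.
by rewrite kappa_junk// derive1nS derive1n1 !derive1_cst0; split; exact: is_derive_cst.
Qed.

Lemma is_cov_frenet1 t : U t -> is_cov gamma c (F 1%N) t (kappa 1%N t *: F 2%N c t).
Proof.
move=> [It ct]; split; last exact: frenet_first hF c t hc It ct.
have [sF _] := frenet_smooth hF (i := 1%N) (ltnW hn).
have Ut : (I `&` gamma @^-1` cdom c) t by [].
by have [] := smooth_on_derivable (x := (t : R^o)) [::] (1 : R^o) (sF c hc) Ut.
Qed.

(** The last Frenet equation takes the general form because [kappa n] is zero, whatever [F n.+1]
    is. *)
Lemma is_cov_frenet i t : (2 <= i <= n)%N -> U t -> is_cov gamma c (F i) t
  (- kappa i.-1 t *: F i.-1 c t + kappa i t *: F i.+1 c t).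
Proof.
move=> /andP[i2 ni] [It ct]; split.
  have [sF _] : smooth_field I gamma (F i).
    by apply: (frenet_smooth hF); rewrite ni (ltnW i2).
  have Ut : (I `&` gamma @^-1` cdom c) t by [].
  by have [] := smooth_on_derivable (x := (t : R^o)) [::] (1 : R^o) (sF c hc) Ut.
have [ni'|] := ltnP i n.
  apply: (frenet_mid hF) => //; rewrite i2/=.
  by case: n ni'.
move=> ni'; have -> : i = n by apply/eqP; rewrite eqn_leq ni.
by rewrite (frenet_last hF)// (frenet_curvature0 hF _ (leqnn n)) scale0r addr0.
Qed.

(* The factor [kappa i] makes this hold also for [i >= n], when [F i.+1] is junk. *)
Lemma is_cov_frenet_scaled (k : R -> R) (dk : R) i t : (1 <= i)%N -> U t ->
  is_derive t 1 k dk ->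
  is_cov gamma c (fun c t => (k t * kappa i t) *: F i.+1 c t) t
    ((dk * kappa i t + k t * derive1 (kappa i) t) *: F i.+1 c t
     + (k t * kappa i t) *: (- kappa i t *: F i c t + kappa i.+1 t *: F i.+2 c t)).
Proof.
move=> i1 Ut hk; have [ni|ni] := ltnP i n.
  apply: (is_covZ (k := fun t => k t * kappa i t)).
    have [hki _] := is_derive_kappa i1 Ut.1.
    apply: (is_derive_eq (is_deriveM hk hki)).
    by rewrite /GRing.scale/=; ring.
  have i2 : (2 <= i.+1 <= n)%N by rewrite ltnS i1.
  exact: is_cov_frenet i2 Ut.
rewrite !(kappa_junk ni) derive1_cst0 !mulr0 addr0 !scale0r addr0.
have E : (fun s : R => (k s * 0) *: F i.+1 c s) = cst 0.
  by apply/funext => s; rewrite mulr0 scale0r.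
split; rewrite /= ?/cov E; first exact: derivable_cst.
rewrite derive1E derive_cst add0r.
by have := christoffel_formZr c (coord gamma c t) 0 (velocity gamma c t) 0;
  rewrite !scale0r /= mulr0 scale0r.
Qed.

Lemma is_cov_velocity t : U t ->
  is_cov gamma c (velocity gamma) t (kappa 1%N t *: F 2%N c t).
Proof.
move=> Ut; apply: (is_cov_near (V := F 1%N)); last exact: is_cov_frenet1.
have := near_curve_domain Ut; apply: filterS => s [Is cs].
exact: frenet_velocity hF c s hc Is cs.
Qed.

Lemma tensionE t : U t -> tension gamma c t = kappa 1%N t *: F 2%N c t.
Proof. by move=> /is_cov_velocity[]. Qed.

Lemma is_cov_tension t : U t -> is_cov gamma c (tension gamma) t
  ((- kappa 1%N t ^+ 2) *: F 1%N c t + derive1 (kappa 1%N) t *: F 2%N c t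
   + (kappa 1%N t * kappa 2%N t) *: F 3%N c t).
Proof.
move=> Ut; apply: (is_cov_near (V := fun c t => kappa 1%N t *: F 2%N c t)).
  by have := near_curve_domain Ut; apply: filterS => s /tensionE.
have [hk _] := is_derive_kappa (leqnn 1) Ut.1.
have [d e] := is_covZ hk (is_cov_frenet (i := 2) hn Ut).
split => //; rewrite {}e scalerDr !scalerA.
by rewrite addrCA addrA mulrN.
Qed.

(** The first coefficient collects [-2] from the derivative of [- kappa 1 ^+ 2] and [-1] from that
    of [F 2]; the factor 2 on [F 3] arises likewise, from [F 2] and from the product
    [kappa 1 * kappa 2]. *)
Lemma is_cov2_tension t : U t -> is_cov gamma c (cov gamma (tension gamma)) t
  ((- 3 * kappa 1%N t * derive1 (kappa 1%N) t) *: F 1%N c t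
   + (derive1n 2 (kappa 1%N) t - kappa 1%N t * kappa 2%N t ^+ 2 - kappa 1%N t ^+ 3)
     *: F 2%N c t
   + (2 * derive1 (kappa 1%N) t * kappa 2%N t + kappa 1%N t * derive1 (kappa 2%N) t) *: F 3%N c t
   + (kappa 1%N t * kappa 2%N t * kappa 3%N t) *: F 4%N c t).
Proof.
move=> Ut; apply: (is_cov_near (V := fun c t =>
    (- kappa 1%N t ^+ 2) *: F 1%N c t + derive1 (kappa 1%N) t *: F 2%N c t
    + (kappa 1%N t * kappa 2%N t) *: F 3%N c t)).
  by have := near_curve_domain Ut; apply: filterS => s /is_cov_tension[_ ->].
have [hk hk'] := is_derive_kappa (leqnn 1) Ut.1.
have hk2 : is_derive t 1 (fun s => - kappa 1%N s ^+ 2) (- (2 * kappa 1%N t * derive1 (kappa 1%N) t)).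
  apply: (is_derive_eq (is_deriveN (is_deriveM hk hk))).
  by rewrite /GRing.scale/=; ring.
(* The [F 3] term needs the scaled rule: for [n = 2] there is no Frenet equation for [F 3], but its
   coefficient vanishes identically. *)
have [d e] := is_covD (is_covD (is_covZ hk2 (is_cov_frenet1 Ut))
  (is_covZ hk' (is_cov_frenet (i := 2) hn Ut)))
  (is_cov_frenet_scaled (i := 2) isT Ut hk).
split => //; rewrite {d}e /=.
by apply/rowP => j; rewrite !mxE; ring.
Qed.

Lemma coord_cimg t : U t -> cimg c (coord gamma c t).
Proof. by move=> [_ ct]; exists (gamma t). Qed.

Lemma inner_frenet i j t : (1 <= i <= n)%N -> (1 <= j <= n)%N -> U t ->
  metric c (coord gamma c t) (F i c t) (F j c t) = (i == j)%:R.
Proof. by move=> i1 j1 [It ct]; exact: (frenet_orthonormal hF) c t hc It ct. Qed.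

(** Lets terms in absent frame vectors be treated like the others, since their coefficients are
    zero. *)
Lemma inner_frenet_scaled i j t (r : R) : (1 <= i)%N -> ((n < i)%N -> r = 0) ->
  (1 <= j <= n)%N -> U t ->
  metric c (coord gamma c t) (r *: F i c t) (F j c t) = r * (i == j)%:R.
Proof.
move=> i1 r0 jn Ut; rewrite /metric gram_formZl.
have [ni|ni] := leqP i n; last by rewrite r0// !mul0r.
by congr (_ * _); apply: inner_frenet => //; rewrite i1.
Qed.

Lemma inner_frenet_eq0 t v : U t ->
  v = 0 <-> forall j, (1 <= j <= n)%N -> metric c (coord gamma c t) v (F j c t) = 0.
Proof.
move=> Ut; split=> [-> j _|v0].
  by rewrite -(scale0r 0) /metric gram_formZl mul0r.
(* Ordinals start at 0 and the frame at 1, hence the shift. *)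
apply: (gram_form_orthonormal_eq0 (A := gmx c (coord gamma c t))
  (e := fun i : 'I_n => F i.+1 c t)) => [i j|j].
  by have := @inner_frenet i.+1 j.+1 t (ltn_ord i) (ltn_ord j) Ut.
exact: (v0 j.+1 (ltn_ord j)).
Qed.

(** The reals [p], [p1], [p2] stand for the values of [f], [2 f'], [f''] at [t]. The Kronecker
    factors give one formula for every [n] and [j]. *)
Lemma inner_f_bitension t j (p p1 p2 : R) : U t -> (1 <= j <= n)%N ->
  metric c (coord gamma c t)
    (p *: bitension gamma c t + p2 *: tension gamma c t
     + p1 *: cov gamma (tension gamma) c t) (F j c t) =
  (p * (- 3 * kappa 1%N t * derive1 (kappa 1%N) t) - p1 * kappa 1%N t ^+ 2)
    * (1 == j)%N%:R
  + (p * (derive1n 2 (kappa 1%N) t - kappa 1%N t * kappa 2%N t ^+ 2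
          - kappa 1%N t ^+ 3)
     + p2 * kappa 1%N t + p1 * derive1 (kappa 1%N) t) * (2 == j)%N%:R
  + (p * (2 * derive1 (kappa 1%N) t * kappa 2%N t
          + kappa 1%N t * derive1 (kappa 2%N) t)
     + p1 * (kappa 1%N t * kappa 2%N t)) * (3 == j)%N%:R
  + p * (kappa 1%N t * kappa 2%N t * kappa 3%N t) * (4 == j)%N%:R
  + p * (kappa 1%N t * curv4 gamma (F 1%N) (F 2%N) (F 1%N) (F j) c t).
Proof.
move=> Ut jn; rewrite /bitension (is_cov2_tension Ut).2 (is_cov_tension Ut).2 (tensionE Ut).
have -> : curv gamma (velocity gamma) (tension gamma) (velocity gamma) c t =
    kappa 1%N t *: curvature c (coord gamma c t) (F 1%N c t) (F 2%N c t) (F 1%N c t).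
  rewrite /curv (tensionE Ut) -(frenet_velocity hF hc Ut.1 Ut.2).
  exact: curvatureZ (coord_cimg Ut).
rewrite /curv4 /curvature4; move: (curvature _ _ _ _ _) => Q.
have k2 : (n < 3)%N -> kappa 2%N = cst 0 by exact: kappa_junk.
have k3 : (n < 4)%N -> kappa 3%N = cst 0 by exact: kappa_junk.
have e1 r : metric c (coord gamma c t) (r *: F 1%N c t) (F j c t) = r * (1 == j)%N%:R.
  by apply: inner_frenet_scaled => //; rewrite ltnNge (ltnW hn).
have e2 r : metric c (coord gamma c t) (r *: F 2%N c t) (F j c t) = r * (2 == j)%N%:R.
  by apply: inner_frenet_scaled => //; rewrite ltnNge hn.
(* Unlike for [F 1] and [F 2], the products with [F 3] and [F 4] are computed only for the actual
   total coefficients, which vanish when [n < 3] and [n < 4] respectively. *)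
pose K3 := p * (2 * derive1 (kappa 1%N) t * kappa 2%N t
          + kappa 1%N t * derive1 (kappa 2%N) t) + p1 * (kappa 1%N t * kappa 2%N t).
have e3 : metric c (coord gamma c t) (K3 *: F 3%N c t) (F j c t) = K3 * (3 == j)%N%:R.
  by apply: inner_frenet_scaled => // /k2; rewrite /K3 => ->; rewrite derive1_cst0 /=; ring.
pose K4 := p * (kappa 1%N t * kappa 2%N t * kappa 3%N t).
have e4 : metric c (coord gamma c t) (K4 *: F 4%N c t) (F j c t) = K4 * (4 == j)%N%:R.
  by apply: inner_frenet_scaled => // /k3; rewrite /K4 => ->; rewrite mulr0 mulr0.
(* The minus sign in [curvature4] absorbs the one before the curvature term of [bitension]. *)
have eQ : p * (kappa 1%N t * - metric c (coord gamma c t) Q (F j c t)) =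
    metric c (coord gamma c t) ((- p * kappa 1%N t) *: Q) (F j c t).
  by rewrite /metric gram_formZl; ring.
rewrite -e1 -e2 -/K3 -e3 -/K4 -e4 eQ /metric -!gram_formDl.
by congr (gram_form _ _ _); apply/rowP => i; rewrite !mxE /K3 /K4; ring.
Qed.

End Frenet.

(** * From the components to the system of equations *)

(** Here [M j] is the component along [F j] and [C j] the curvature term. For each [j] a single
    Kronecker factor survives at most, and [M j] is [f] times the [j]-th equation; [C 1 = 0] removes
    the curvature from the first. *)
Lemma frenet_componentsP (R : fieldType) n (M C : nat -> R)
    (f f' f'' k1 k1' k1'' k2 k2' k3 : R) : f != 0 -> (2 <= n)%N -> C 1%N = 0 ->
  (forall j, (1 <= j <= n)%N -> M j =
    (f * (- 3 * k1 * k1') - 2 * f' * k1 ^+ 2) * (1 == j)%N%:R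
    + (f * (k1'' - k1 * k2 ^+ 2 - k1 ^+ 3) + f'' * k1 + 2 * f' * k1') * (2 == j)%N%:R
    + (f * (2 * k1' * k2 + k1 * k2') + 2 * f' * (k1 * k2)) * (3 == j)%N%:R
    + f * (k1 * k2 * k3) * (4 == j)%N%:R + f * (k1 * C j)) ->
  (forall j, (1 <= j <= n)%N -> M j = 0) <->
  [/\ - 3 * k1 * k1' - 2 * k1 ^+ 2 * (f' / f) = 0,
      k1'' - k1 * k2 ^+ 2 - k1 ^+ 3 + k1 * C 2%N + k1 * (f'' / f)
        + 2 * k1' * (f' / f) = 0,
      (3 <= n)%N -> 2 * k1' * k2 + k1 * k2' + k1 * C 3%N + 2 * k1 * k2 * (f' / f) = 0,
      (4 <= n)%N -> k1 * k2 * k3 + k1 * C 4%N = 0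
    & forall j, (5 <= j <= n)%N -> k1 * C j = 0].
Proof.
move=> f0 hn C1 ME.
have n1 : (1 <= 1 <= n)%N by rewrite (ltnW hn).
have n2 : (1 <= 2 <= n)%N by rewrite hn.
split=> [E|[E1 E2 E3 E4 E5] j jn].
  split=> [||n3|n4|j /andP[j5 jn]]; apply: (mulfI f0); rewrite mulr0.
  - by rewrite -[RHS](E _ n1) ME// C1 /=; field.
  - by rewrite -[RHS](E _ n2) ME//=; field.
  - by rewrite -[RHS](E 3%N) ?ME//=; field.
  - by rewrite -[RHS](E 4%N) ?ME//=; field.
  - have j1 : (1 <= j <= n)%N by rewrite jn (ltn_trans _ j5).
    rewrite -[RHS](E _ j1) ME//.
    by case: j j5 {jn j1} => [|[|[|[|[|j]]]]]//= _; field.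
rewrite ME// -[RHS](mulr0 f).
case: j jn => [|[|[|[|[|j]]]]]//= jn.
- by rewrite -E1 C1; field.
- by rewrite -E2; field.
- by rewrite -(E3 jn); field.
- by rewrite -(E4 jn); field.
- by rewrite -(E5 j.+4.+1 jn); field.
Qed.

Theorem lemma2p1 (R : realType) (n : nat) (hn : (2 <= n)%N)
    (N : riemannian_manifold R n) (a b : \bar R) (gamma : R -> N)
    (F : nat -> field N) (kappa : nat -> R -> R) (f : R -> R)
    (I := [set t : R | (a < t%:E < b)%E])
    (hgamma : smooth_curve I gamma)
    (harc : arclength I gamma)
    (hF : frenet_frame I gamma F kappa)
    (hf : smooth_on (V := R^o) (W := R^o) I f)
    (hf0 : forall t, I t -> 0 < f t) :
  f_biharmonic I gamma f <->
  along I gamma (fun c t =>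
    [/\ - 3 * kappa 1%N t * derive1 (kappa 1%N) t
          - 2 * kappa 1%N t ^+ 2 * (derive1 f t / f t) = 0,
        derive1n 2 (kappa 1%N) t - kappa 1%N t * kappa 2%N t ^+ 2 - kappa 1%N t ^+ 3
          + kappa 1%N t * curv4 gamma (F 1%N) (F 2%N) (F 1%N) (F 2%N) c t
          + kappa 1%N t * (derive1n 2 f t / f t)
          + 2 * derive1 (kappa 1%N) t * (derive1 f t / f t) = 0,
        (3 <= n)%N ->
          2 * derive1 (kappa 1%N) t * kappa 2%N t + kappa 1%N t * derive1 (kappa 2%N) t
          + kappa 1%N t * curv4 gamma (F 1%N) (F 2%N) (F 1%N) (F 3%N) c t
          + 2 * kappa 1%N t * kappa 2%N t * (derive1 f t / f t) = 0,
        (4 <= n)%N ->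
          kappa 1%N t * kappa 2%N t * kappa 3%N t
          + kappa 1%N t * curv4 gamma (F 1%N) (F 2%N) (F 1%N) (F 4%N) c t = 0
      & forall j, (5 <= j <= n)%N ->
          kappa 1%N t * curv4 gamma (F 1%N) (F 2%N) (F 1%N) (F j) c t = 0]).
Proof.
have oI : open I := @open_itv_ereal R a b.
(* Both sides are [along] statements, so the equivalence is proved at one chart and one time. *)
have pointwise (P Q : chart R n N -> R -> Prop) :
    (forall c t, atlas c -> I t -> cdom c (gamma t) -> (P c t <-> Q c t)) ->
    along I gamma P <-> along I gamma Q.
  by move=> PQ; split=> H c t hc It ct; apply/(PQ c t hc It ct)/H.
apply: pointwise => c t hc It ct.
have Ut : I t /\ cdom c (gamma t) by [].
apply: (iff_trans (inner_frenet_eq0 hF hc _ Ut)).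
have f0 : f t != 0 by rewrite gt_eqF// hf0.
have proj j (jn : (1 <= j <= n)%N) := inner_f_bitension hn oI hgamma hF hc
  (f t) (2 * derive1 f t) (derive1n 2 f t) Ut jn.
(* The last two arguments coincide, so skewness of the operator R(F_1,F_2) applies. *)
have skew : curv4 gamma (F 1%N) (F 2%N) (F 1%N) (F 1%N) c t = 0.
  by rewrite /curv4 /curvature4 curvature_skew ?oppr0//; exact: coord_cimg Ut.
exact: (frenet_componentsP
  (C := fun j => curv4 gamma (F 1%N) (F 2%N) (F 1%N) (F j) c t) f0 hn skew proj).
Qed.
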